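(* Let $n\geqslant 1$, let $T$ be a maximal torus of $SO_{2n+1}(\Bbbk)$ and $N(T)$ its normalizer in $SO_{2n+1}(\Bbbk)$. Encode the connected components of $N(T)$ by pairs $(\sigma,\theta)$ with $\sigma\in S_n$, $\theta=(\varepsilon_1,\ldots,\varepsilon_n)\in\{\pm1\}^n$. Let $\sigma=(i_{1,1},\ldots,i_{1,s_1})\cdots(i_{k,1},\ldots,i_{k,s_k})$ be the decomposition of $\sigma$ into a product of independent cycles (cycles of length $1$ included). Then the component corresponding to $(\sigma,\theta)$ is periodic if and only if $$\prod_{q=1}^{s_j}\varepsilon_{i_{j,q}}=-1\quad\text{for all } j=1,\ldots,k,$$ and in this case every element of the component has order $2\cdot\operatorname{lcm}(s_1,\ldots,s_k)$.
   Context: $\Bbbk$ is an algebraically closed field of characteristic zero. A connected component of an affine algebraic group is called periodic if all its elements have finite order. Realize $SO_{2n+1}(\Bbbk)=\{g\in SL_{2n+1}(\Bbbk)\mid g^T\Omega g=\Omega\}$, where $\Omega$ is the matrix with ones on the secondary diagonal and zeros elsewhere, and let $T=\{\operatorname{diag}(t_1,\ldots,t_n,1,t_n^{-1},\ldots,t_1^{-1})\mid t_i\in\Bbbk^*\}$, with characters $\chi_j(t)=t_j$, $j=1,\ldots,n$. For $g\in N(T)$ the automorphism $t\mapsto gtg^{-1}$ of $T$ induces an automorphism $A_g$ of the character lattice, $(A_g\lambda)(t)=\lambda(gtg^{-1})$, whose matrix in the basis $\chi_1,\ldots,\chi_n$ is a monomial $(0,1,-1)$-matrix. The component $gT$ corresponds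 to the pair $(\sigma,\theta)$ determined by $A_g\chi_j=\varepsilon_j\chi_{\sigma(j)}$ for $j=1,\ldots,n$; all pairs in $S_n\times\{\pm1\}^n$ arise, each from exactly one component. *)

(* Defs.v *)
From mathcomp Require Import all_boot all_order all_fingroup all_algebra.
From mathcomp Require Import mpoly.

Set Implicit Arguments.
Unset Strict Implicit.
Unset Printing Implicit Defensive.

Import GRing.Theory.
Local Open Scope ring_scope.

Section Zariski.

Variables (K : fieldType) (m : nat).
Implicit Types (X Y Z C D : 'M[K]_m -> Prop).

(* The polynomials are in the m * m matrix entries, listed by mxvec. *)
Definition zariski_closed Z : Prop :=
  exists I : {mpoly K[m * m]} -> Prop,
    forall A, Z A <-> (forall p, I p -> p.@[fun i => mxvec A 0 i] = 0).

(* Connectedness in the subspace topology; connected sets are nonempty. *)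
Definition zariski_connected X : Prop :=
  (exists A, X A) /\
  (forall Z1 Z2, zariski_closed Z1 -> zariski_closed Z2 ->
     (forall A, X A -> Z1 A \/ Z2 A) ->
     (exists A, X A /\ Z1 A) -> (exists A, X A /\ Z2 A) ->
     exists A, [/\ X A, Z1 A & Z2 A]).

Definition connected_component X C : Prop :=
  [/\ zariski_connected C,
      forall A, C A -> X A &
      forall D, zariski_connected D -> (forall A, D A -> X A) ->
        (forall A, C A -> D A) -> forall A, D A -> C A].

End Zariski.

Section Orders.

Variables (K : fieldType) (m : nat).
Implicit Types (g : 'M[K]_m.+1) (C : 'M[K]_m.+1 -> Prop).

Definition finite_order g : Prop := exists2 d, (0 < d)%N & g ^+ d = 1.

Definition has_order g (d : nat) : Prop :=
  [/\ (0 < d)%N, g ^+ d = 1 & forall e, (0 < e)%N -> g ^+ e = 1 -> (d <= e)%N].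

Definition periodic C : Prop := forall g, C g -> finite_order g.

End Orders.

Section SpecialOrthogonal.

Variables (K : fieldType) (n : nat).
Local Notation M := 'M[K]_((2 * n).+1).

Definition Omega : M := \matrix_(i, j) (j == rev_ord i)%:R.

Definition SO_odd (g : M) : Prop := \det g = 1 /\ g^T * Omega * g = Omega.

(* diag (t_0, ..., t_(n-1), 1, t_(n-1)^-1, ..., t_0^-1): [insub] recognizes
   the indices i < n, respectively those whose mirror image is < n. *)
Definition torus_elt (t : 'I_n -> K) : M :=
  diag_mx (\row_i
    if insub (val i) is Some j then t j
    else if insub (val (rev_ord i)) is Some j then (t j)^-1
    else 1).

Definition torus (A : M) : Prop :=
  exists2 t : 'I_n -> K, (forall j, t j != 0) & A = torus_elt t.

Definition torus_normalizer (g : M) : Prop :=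
  SO_odd g /\ (forall t, torus t <-> torus (g * t * g^-1)).

Definition chi (j : 'I_n) (t : M) : K := t (inord j) (inord j).

Definition char_action (g : M) (lambda : M -> K) : M -> K :=
  fun t => lambda (g * t * g^-1).

(* A_g chi_j = eps_j chi_(sigma j), the character lattice being written
   additively: eps_j is an exponent on values. *)
Definition induces (g : M) (sigma : 'S_n) (eps : 'I_n -> int) : Prop :=
  forall j t, torus t -> char_action g (chi j) t = chi (sigma j) t ^ eps j.

Definition corresponds (C : M -> Prop) (sigma : 'S_n) (eps : 'I_n -> int) :
    Prop :=
  exists2 g, C g & induces g sigma eps.

End SpecialOrthogonal.

(* Main.v *)
From Stdlib Require Import Classical.
Require Import Defs.
From mathcomp Require Import all_boot all_order all_fingroup all_algebra.
From mathcomp Require Import mpoly zify ring.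

(* Conjugating a torus element with pairwise distinct eigenvalues shows that
   every g in N(T) is monomial: its a-th row is supported in one column w a.
   On matrices of N(T), "support w" and "some entry (a, w a) vanishes" are
   complementary closed conditions, so w is constant on a connected component C;
   conversely C is stable under right translation by one-parameter subgroups of
   T, because a curve x |-> g t(x) is connected (its coordinates are Laurent
   polynomials in x) and C is maximal.
     The map w permutes the weights chi_j, chi_j^-1, 0 as (sigma, theta) does.
   Around a cycle of length s and sign -1, w ^ s exchanges a and its mirror image
   a'; orthogonality makes the entries of g at a and a' mutually inverse, so
   g ^ (2 s) is the identity there, and 2 s is the exact order of w on the cycle.
   Around a cycle of sign 1, w ^ s fixes a, and translating g by a one-parameter
   subgroup gives the a-th diagonal entry of g ^ s any nonzero value, for instance
   2, which has infinite order. *)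

Set Implicit Arguments.
Unset Strict Implicit.
Unset Printing Implicit Defensive.

Import GRing.Theory.
Local Open Scope ring_scope.

(** * Two facts on the base field *)

Lemma pchar0_natr_inj (K : fieldType) :
  [pchar K] =i pred0 -> injective (fun k : nat => k%:R : K).
Proof.
move=> /pcharf0P charK0.
have wlog_le k l : (k <= l)%N -> k%:R = l%:R :> K -> k = l.
  move=> le_kl /eqP; rewrite eq_sym -subr_eq0 -natrB // charK0; lia.
move=> k l /= eq_kl; case/orP: (leq_total k l) => le_kl; first exact: wlog_le.
by apply/esym/wlog_le.
Qed.

(** The polynomial [p + 1] only takes the value 1, so it has no root and must be constant. *)
Lemma closed_field_poly_eq0 (K : closedFieldType) (p : {poly K}) :
  (forall x, p.[x] = 0) -> p = 0.
Proof.
move=> p0; have [|no_root] := boolP (size (p + 1) != 1%N).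
  move=> /closed_rootP[x]; rewrite /root hornerD hornerC p0 add0r.
  by rewrite oner_eq0.
have/size_poly1P[c _ pc] := negPn no_root.
have pE : p = (c - 1)%:P by rewrite polyCB -pc addrK.
by have := p0 0; rewrite pE hornerC => ->; rewrite polyC0.
Qed.

(** * Laurent polynomial functions on the punctured line *)

Section LaurentFunctions.

Variable K : closedFieldType.
Implicit Types f g : K -> K.

(** Values at 0 are unconstrained; plain functions let matrix entries along a curve be used
    directly. *)
Definition laurent f :=
  exists N, exists P : {poly K}, forall x, x != 0 -> f x * x ^+ N = P.[x].

Lemma laurent_cst c : laurent (fun=> c).
Proof. by exists 0%N, c%:P => x _; rewrite hornerC mulr1. Qed.

Lemma laurent_id : laurent id.
Proof. by exists 0%N, 'X => x _; rewrite hornerX mulr1. Qed.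

Lemma laurent_inv : laurent (fun x => x^-1).
Proof. by exists 1%N, 1 => x x0; rewrite hornerC mulVf. Qed.

Lemma laurentM f g : laurent f -> laurent g -> laurent (fun x => f x * g x).
Proof.
move=> [N [P fP]] [M [Q gQ]]; exists (N + M)%N, (P * Q) => x x0.
by rewrite hornerM -fP // -gQ // exprD mulrACA.
Qed.

Lemma laurentD f g : laurent f -> laurent g -> laurent (fun x => f x + g x).
Proof.
move=> [N [P fP]] [M [Q gQ]]; exists (N + M)%N, (P * 'X^M + Q * 'X^N) => x x0.
by rewrite hornerD !hornerM !hornerXn -fP // -gQ // exprD; ring.
Qed.

Lemma laurentX f k : laurent f -> laurent (fun x => f x ^+ k).
Proof.
move=> Lf; elim: k => [|k IHk]; first exact: laurent_cst.
have [N [P fP]] := laurentM Lf IHk.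
by exists N, P => x x0; rewrite exprS fP.
Qed.

Lemma laurent_sum I (r : seq I) (F : I -> K -> K) :
  (forall i, laurent (F i)) -> laurent (fun x => \sum_(i <- r) F i x).
Proof.
move=> LF; elim: r => [|i r IHr].
  by exists 0%N, 0 => x _; rewrite big_nil horner0 mul0r.
have [N [P fP]] := laurentD (LF i) IHr.
by exists N, P => x x0; rewrite big_cons fP.
Qed.

Lemma laurent_prod I (r : seq I) (F : I -> K -> K) :
  (forall i, laurent (F i)) -> laurent (fun x => \prod_(i <- r) F i x).
Proof.
move=> LF; elim: r => [|i r IHr].
  by exists 0%N, 1 => x _; rewrite big_nil hornerC mulr1.
have [N [P fP]] := laurentM (LF i) IHr.
by exists N, P => x x0; rewrite big_cons fP.
Qed.

Lemma laurent_meval m (v : K -> 'I_m -> K) (p : {mpoly K[m]}) :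
  (forall i, laurent (v^~ i)) -> laurent (fun x => p.@[v x]).
Proof.
move=> Lv; have: laurent (fun x => \sum_(s <- msupp p) p@_s *
    \prod_i v x i ^+ s i).
  apply: laurent_sum => s; apply: laurentM; first exact: laurent_cst.
  by apply: laurent_prod => i; apply: laurentX.
by case=> N [P fP]; exists N, P => x x0; rewrite mevalE fP.
Qed.

(** The punctured line is irreducible: with denominators cleared, [P * Q * 'X] vanishes everywhere,
    the factor ['X] taking care of 0, and polynomials form a domain. *)
Lemma laurent_mul_eq0 f g : laurent f -> laurent g ->
    (forall x, x != 0 -> f x = 0 \/ g x = 0) ->
  (forall x, x != 0 -> f x = 0) \/ (forall x, x != 0 -> g x = 0).
Proof.
move=> [N [P fP]] [M [Q gQ]] fg0.
have: P * Q * 'X = 0.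
  apply: closed_field_poly_eq0 => x; rewrite hornerM hornerX.
  have [->|x0] := eqVneq x 0; first by rewrite mulr0.
  rewrite hornerM -fP // -gQ //.
  by case: (fg0 x x0) => ->; rewrite !(mul0r, mulr0).
have kill (h : K -> K) k R x : x != 0 ->
    h x * x ^+ k = R.[x] -> R = 0 -> h x = 0.
  move=> x0 hR R0; move: hR; rewrite R0 horner0 => /eqP.
  by rewrite mulf_eq0 expf_eq0 (negPf x0) andbF orbF => /eqP.
move/eqP; rewrite !mulf_eq0 polyX_eq0 orbF => /orP[]/eqP R0; [left|right].
  by move=> x x0; apply: (kill f N P x x0) => //; apply: fP.
by move=> x x0; apply: (kill g M Q x x0) => //; apply: gQ.
Qed.

End LaurentFunctions.

(** * Zariski-connected sets of matrices and closed conditions on supports *)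

Section ZariskiConnected.

Variable m : nat.

(** If [h x2] misses [Z1], some equation [p] of [Z1] is nonzero there. For every equation [q] of
    [Z2], one of [p], [q] vanishes at each point of the curve, so irreducibility makes [q] vanish
    along it, which puts [h x1] in [Z2]. *)
Lemma laurent_curve_connected (K : closedFieldType) (h : K -> 'M[K]_m) :
    (forall a b, laurent (fun x => h x a b)) ->
  zariski_connected (fun A => exists2 x, x != 0 & A = h x).
Proof.
move=> Lh; split; first by exists (h 1), 1; rewrite ?oner_neq0.
move=> Z1 Z2 [I1 I1P] [I2 I2P] cover [_ [[x1 x1_0 ->] Z1x1]]
  [_ [[x2 x2_0 ->] Z2x2]].
have Leval p : laurent (fun x => p.@[fun i => mxvec (h x) 0 i]).
  apply: laurent_meval; case/mxvec_indexP => a b.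
  have [N [P LP]] := Lh a b.
  by exists N, P => x x0; rewrite mxvecE LP.
have alt p q : I1 p -> I2 q -> p.@[fun i => mxvec (h x2) 0 i] = 0 \/
    q.@[fun i => mxvec (h x1) 0 i] = 0.
  move=> Ip Iq.
  have [x x0| |] := laurent_mul_eq0 (Leval p) (Leval q); last 2 first.
  - by left; auto.
  - by right; auto.
  case: (cover (h x)); first by exists x.
    by move/I1P/(_ p Ip); left.
  by move/I2P/(_ q Iq); right.
have [Z1x2|nZ1x2] := classic (Z1 (h x2)); first by exists (h x2); split; eauto.
have [p nIp] : exists p, ~ (I1 p -> p.@[fun i => mxvec (h x2) 0 i] = 0).
  by apply: not_all_ex_not => all0; apply/nZ1x2/I1P.
have [Ip npx2] := imply_to_and _ _ nIp.
exists (h x1); split; [by exists x1 | by [] | apply/I2P => q Iq].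
by case: (alt p q Ip Iq).
Qed.

(** The common point [A0] lies in one closed set; whichever of [X] and [Y] meets the other closed
    set then meets both. *)
Lemma zariski_connectedU (K : fieldType) (X Y : 'M[K]_m -> Prop) A0 :
    zariski_connected X -> zariski_connected Y -> X A0 -> Y A0 ->
  zariski_connected (fun A => X A \/ Y A).
Proof.
move=> [_ conX] [_ conY] XA0 YA0; split; first by exists A0; left.
have main Z1 Z2 : zariski_closed Z1 -> zariski_closed Z2 ->
    (forall A, X A \/ Y A -> Z1 A \/ Z2 A) -> Z1 A0 ->
    (exists A, (X A \/ Y A) /\ Z2 A) ->
    exists A, [/\ X A \/ Y A, Z1 A & Z2 A].
  move=> cZ1 cZ2 cover Z1A0 [A [[XA|YA] Z2A]].
    have [|||B [XB Z1B Z2B]] := conX _ _ cZ1 cZ2.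
    - by move=> B XB; apply: cover; left.
    - by exists A0.
    - by exists A.
    by exists B; split=> //; left.
  have [|||B [YB Z1B Z2B]] := conY _ _ cZ1 cZ2.
  - by move=> B YB; apply: cover; right.
  - by exists A0.
  - by exists A.
  by exists B; split=> //; right.
move=> Z1 Z2 cZ1 cZ2 cover meet1 meet2.
case: (cover A0 (or_introl XA0)) => ZA0; first exact: main.
have [|B [EB ? ?]] := main Z2 Z1 cZ2 cZ1 _ ZA0 meet1.
  by move=> A /cover[]; [right|left].
by exists B.
Qed.

Lemma zariski_closed_support (K : fieldType) (w : 'I_m -> 'I_m) :
  zariski_closed (fun A : 'M[K]_m => forall a b, b != w a -> A a b = 0).
Proof.
exists (fun p => exists a b, b != w a /\ p = 'X_(mxvec_index a b)) => A.
split=> [A0 _ [a [b [ne ->]]]|A0 a b ne]; first by rewrite mevalXU mxvecE A0.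
by rewrite -mxvecE -mevalXU; apply: A0; exists a, b.
Qed.

Lemma zariski_closed_prod (K : fieldType) (w : 'I_m -> 'I_m) :
  zariski_closed (fun A : 'M[K]_m => \prod_a A a (w a) = 0).
Proof.
exists (fun p => p = \prod_a 'X_(mxvec_index a (w a))) => A.
have E : (\prod_a 'X_(mxvec_index a (w a))).@[fun i => mxvec A 0 i] =
    \prod_a A a (w a).
  by rewrite rmorph_prod; apply: eq_bigr => a _; rewrite /= mevalXU mxvecE.
by split=> [A0 _ ->|/(_ _ erefl)]; rewrite E.
Qed.

End ZariskiConnected.

(** * Powers of matrices with at most one nonzero entry per row *)

Section Monomial.

Variables (K : fieldType) (m : nat).
Implicit Types (g : 'M[K]_m.+1) (w : 'I_m.+1 -> 'I_m.+1).

(** The entries at [w a] may vanish, which keeps the condition Zariski closed. *)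
Definition supported w g := forall a b, b != w a -> g a b = 0.

(** Within the support, a single path of length [k] leaves [a]. *)
Lemma supportedX w g k a b : supported w g ->
  (g ^+ k) a b =
    (\prod_(i < k) g (iter i w a) (iter i.+1 w a)) *+ (b == iter k w a).
Proof.
move=> gw; elim: k a => [|k IHk] a.
  by rewrite expr0 big_ord0 mxE /= eq_sym.
rewrite exprS mxE (bigD1 (w a)) //= big1 ?addr0 => [|c /gw->]; last first.
  by rewrite mul0r.
rewrite IHk big_ord_recl /= -iterSr mulrnAr.
by under eq_bigr do rewrite -!iterSr.
Qed.

Lemma row_expM g a c k q : row a (g ^+ k) = c *: row a 1%:M ->
  row a (g ^+ (q * k)) = c ^+ q *: row a 1%:M.
Proof.
move=> gk; elim: q => [|q IHq]; first by rewrite mul0n !expr0 scale1r.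
by rewrite mulSn exprD -mulmxE row_mul gk -scalemxAl -row_mul mul1mx IHq scalerA exprS.
Qed.

Lemma row_exp_eq1 g a k l : (k %| l)%N ->
  row a (g ^+ k) = row a 1%:M -> row a (g ^+ l) = row a 1%:M.
Proof.
case/dvdnP=> q -> gk; rewrite (@row_expM g a 1) ?scale1r //.
by rewrite expr1n scale1r.
Qed.

Lemma supportedX_eq1_fixed w g e a : supported w g -> g ^+ e = 1 ->
  iter e w a = a.
Proof.
move=> gw ge1; have := congr1 (fun A : 'M_ _ => A a a) ge1.
rewrite (supportedX _ _ _ gw) !mxE eqxx eq_sym.
by case: eqP => // _ /eqP; rewrite eq_sym oner_eq0.
Qed.

End Monomial.

(** * The torus, orthogonality and the supports of normalizer elements *)

Section TorusNormalizer.

Variables (K : fieldType) (n : nat).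
Local Notation M := 'M[K]_((2 * n).+1).
Local Notation I := 'I_((2 * n).+1).
Implicit Types (g A : M) (a b i : I) (j : 'I_n).
Local Notation Om := (Omega K n).

Definition pos_ord j : I := inord j.

Lemma val_pos_ord j : pos_ord j = j :> nat.
Proof. by rewrite /pos_ord /= inordK //; have := ltn_ord j; lia. Qed.

Lemma pos_ord_inj : injective pos_ord.
Proof.
move=> i j eq_ij; apply: val_inj.
by rewrite /= -val_pos_ord eq_ij val_pos_ord.
Qed.

Lemma rev_ord_fixed a : (rev_ord a == a) = (val a == n).
Proof. by rewrite -val_eqE /=; have := ltn_ord a; lia. Qed.

Lemma pos_ord_neq_rev j k : pos_ord j != rev_ord (pos_ord k).
Proof.
rewrite -val_eqE /= !val_pos_ord.
by have := ltn_ord j; have := ltn_ord k; lia.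
Qed.

Variant ord_spec : I -> Type :=
| OrdPos j : ord_spec (pos_ord j)
| OrdNeg j : ord_spec (rev_ord (pos_ord j))
| OrdMid a of rev_ord a = a : ord_spec a.

Lemma ordP a : ord_spec a.
Proof.
have [lt_an|le_na] := ltnP a n.
  have -> : a = pos_ord (Ordinal lt_an) by apply: val_inj; rewrite /= val_pos_ord.
  exact: OrdPos.
have [/eqP|ne_an] := boolP (val a == n).
  by move/eqP; rewrite -rev_ord_fixed => /eqP/OrdMid.
have lt_n : (rev_ord a < n)%N.
  by move: ne_an le_na => /=; have := ltn_ord a; rewrite /=; lia.
have -> : a = rev_ord (pos_ord (Ordinal lt_n)).
  by apply: (can_inj rev_ordK); rewrite rev_ordK; apply: val_inj;
     rewrite /= val_pos_ord.
exact: OrdNeg.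
Qed.

(** Trades the positional cases of [torus_elt] for conditions symmetric under [rev_ord]. *)
Lemma torusP A : torus A <-> exists d : 'rV[K]_((2 * n).+1),
  [/\ A = diag_mx d, forall a, d 0 a * d 0 (rev_ord a) = 1 &
      forall a, rev_ord a = a -> d 0 a = 1].
Proof.
pose F (t : 'I_n -> K) a := if insub (val a) is Some j then t j
  else if insub (val (rev_ord a)) is Some j then (t j)^-1 else 1.
have Fpos t j : F t (pos_ord j) = t j.
  rewrite /F /= val_pos_ord; case: insubP => [u _ uj|]; last by rewrite ltn_ord.
  by congr (t _); apply: val_inj.
have Fneg t j : F t (rev_ord (pos_ord j)) = (t j)^-1.
  rewrite /F rev_ordK /= val_pos_ord insubF; last first.
    by have := ltn_ord j; rewrite /=; lia.
  case: insubP => [u _ uj|]; last by rewrite ltn_ord.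
  by congr (t _)^-1; apply: val_inj.
have Fmid t a : rev_ord a = a -> F t a = 1.
  move=> ra; have /eqP an : val a == n by rewrite -rev_ord_fixed ra.
  by rewrite /F ra an !insubF // ltnn.
have teltE t : torus_elt t = diag_mx (\row_a F t a) by [].
split=> [[t t0 ->]|[d [-> drev dmid]]].
  exists (\row_a F t a); split=> // a; last by move=> ?; rewrite mxE Fmid.
  rewrite !mxE; case: (ordP a) => [j|j|{}a ra].
  - by rewrite Fpos Fneg mulfV.
  - by rewrite rev_ordK Fpos Fneg mulVf.
  by rewrite ra Fmid // mulr1.
have d0 a : d 0 a != 0.
  by apply: contraTneq (oner_neq0 K) => d0; rewrite -(drev a) d0 mul0r eqxx.
exists (fun j => d 0 (pos_ord j)) => //.
rewrite teltE; congr diag_mx; apply/rowP => a; rewrite mxE.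
case: (ordP a) => [j|j|{}a ra]; last by rewrite Fmid // dmid.
  by rewrite Fpos.
by rewrite Fneg; apply: (mulfI (d0 (pos_ord j))); rewrite drev mulfV.
Qed.

Lemma mul_Omega A a b : (A * Om) a b = A a (rev_ord b).
Proof.
rewrite mxE (bigD1 (rev_ord b)) //= mxE rev_ordK eqxx mulr1 big1 ?addr0 //.
move=> c; rewrite mxE -(inj_eq rev_ord_inj) rev_ordK eq_sym => /negPf->.
by rewrite mulr0.
Qed.

Lemma Omega_sqr : Om * Om = 1.
Proof. by apply/matrixP => a b; rewrite mul_Omega !mxE (inj_eq rev_ord_inj) eq_sym. Qed.

Lemma SO_odd_unit g : SO_odd g -> g \is a GRing.unit.
Proof. by case=> detg _; rewrite -[_ \is a _]/(g \in unitmx) unitmxE detg unitr1. Qed.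

(** The defining identity makes [Om * g^T * Om] a left inverse of [g], hence a right one. This form
    suits supports, which are given row by row. *)
Lemma SO_odd_row g : SO_odd g -> g * Om * g^T = Om.
Proof.
case=> _ gO; have: (Om * g^T * Om) * g = 1.
  by rewrite -!mulrA [g^T * _]mulrA gO Omega_sqr.
move=> /mulmx1C; rewrite mulmxE !mulrA => gO'.
by rewrite -[LHS]mulr1 -Omega_sqr mulrA gO' mul1r.
Qed.

Section Support.

Variables (g : M) (w : I -> I).
Hypotheses (gSO : SO_odd g) (gw : supported w g).

Lemma SO_odd_supported_rev1 a : g a (w a) * g (rev_ord a) (rev_ord (w a)) = 1.
Proof.
have := congr1 (fun A : M => A a (rev_ord a)) (SO_odd_row gSO).
rewrite mxE (bigD1 (rev_ord (w a))) //= big1 ?addr0; last first.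
  move=> c; rewrite mul_Omega -(inj_eq rev_ord_inj) rev_ordK => /gw->.
  by rewrite mul0r.
by rewrite mul_Omega rev_ordK !mxE eqxx.
Qed.

Lemma SO_odd_supported_neq0 a : g a (w a) != 0.
Proof.
apply: contraTneq (oner_neq0 K) => g0.
by rewrite -(SO_odd_supported_rev1 a) g0 mul0r eqxx.
Qed.

Lemma SO_odd_supported_rev a : w (rev_ord a) = rev_ord (w a).
Proof.
apply/esym/eqP; apply: contraTT (oner_neq0 K) => /gw g0.
by rewrite -(SO_odd_supported_rev1 a) g0 mulr0 eqxx.
Qed.

Lemma SO_odd_supported_mulrev a : g a (w a) * g (rev_ord a) (w (rev_ord a)) = 1.
Proof. by rewrite SO_odd_supported_rev SO_odd_supported_rev1. Qed.

End Support.

Lemma torus_normalizer_conj g t : torus_normalizer g -> torus t ->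
  exists d : 'rV[K]_((2 * n).+1),
    g * t * g^-1 = diag_mx d /\ g * t = diag_mx d * g.
Proof.
move=> [gSO gT] /gT/torusP[d [gt _ _]]; exists d; split=> //.
by rewrite -gt mulrVK // SO_odd_unit.
Qed.

(** The exponents [n - a] are distinct and change sign under [rev_ord]; in characteristic zero the
    powers of 2 stay distinct. *)
Lemma torus_regular : [pchar K] =i pred0 ->
  exists2 d : 'rV[K]_((2 * n).+1), torus (diag_mx d) & injective (d 0).
Proof.
move=> charK0; have two_neq0 : 2%:R != 0 :> K.
  by have /pcharf0P-> := charK0.
(* e a = 2 ^ (n - a) *)
pose e a : K := 2%:R ^+ (rev_ord a) / 2%:R ^+ n.
exists (\row_a e a).
  apply/torusP; exists (\row_a e a); split=> // a; rewrite !mxE /e; last first.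
    by move=> ra; rewrite ra; have /eqP-> : val a == n
         by [rewrite -rev_ord_fixed ra]; rewrite mulfV // expf_neq0.
  rewrite mulrACA -exprD -invfM -exprD.
  rewrite rev_ordK (_ : (rev_ord a + a)%N = (n + n)%N) ?mulfV ?expf_neq0 //=.
  by have := ltn_ord a; lia.
move=> a b; rewrite !mxE /e => /mulIf; rewrite invr_eq0 expf_neq0 //.
move=> /(_ isT); rewrite -!natrX => /(pchar0_natr_inj charK0)/eqP.
by rewrite eqn_exp2l // => /eqP/val_inj/rev_ord_inj.
Qed.

Lemma torus_normalizer_supported g : [pchar K] =i pred0 ->
  torus_normalizer g -> exists w, supported w g.
Proof.
move=> charK0 Ng; have [gSO _] := Ng.
have [d Td d_inj] := torus_regular charK0.
have [d' [_ gd]] := torus_normalizer_conj Ng Td.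
have d'E a b : g a b != 0 -> d 0 b = d' 0 a.
  move=> gab; have := congr1 (fun A : M => A a b) gd.
  rewrite -!mulmxE mul_mx_diag mul_diag_mx !mxE mulrC => /mulIf.
  by apply.
(* The default [a] is reached only for a zero row, where any column would do. *)
exists (fun a => odflt a [pick b | g a b != 0]) => a b.
case: pickP => [c gac|/(_ b)/negbFE/eqP->//] /=.
apply: contraNeq => gab; apply/eqP/d_inj.
by rewrite (d'E a b) ?(d'E a c).
Qed.

(** The one-parameter subgroup of the torus dual to [chi j]. *)
Definition subtorus j (x : K) : M :=
  diag_mx (\row_a if a == pos_ord j then x
                  else if a == rev_ord (pos_ord j) then x^-1 else 1).

Lemma torus_subtorus j x : x != 0 -> torus (subtorus j x).
Proof.
move=> x0; apply/torusP; eexists; split; first by [].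
  move=> a; rewrite !mxE; case: (ordP a) => [k|k|{}a ra].
  - rewrite (inj_eq rev_ord_inj) !(inj_eq pos_ord_inj) eq_sym.
    rewrite ![rev_ord _ == _]eq_sym !(negPf (pos_ord_neq_rev _ _)).
    by case: eqP; rewrite ?mulfV ?mulr1.
  - rewrite rev_ordK (inj_eq rev_ord_inj) !(inj_eq pos_ord_inj).
    rewrite ![rev_ord _ == _]eq_sym !(negPf (pos_ord_neq_rev _ _)).
    by case: eqP; rewrite ?mulVf ?mulr1.
  rewrite ra; case: eqP => [ej|_].
    by have := pos_ord_neq_rev j j; rewrite -ej ra eqxx.
  case: eqP => [ej|_]; last by rewrite mulr1.
  by have := pos_ord_neq_rev j j; rewrite -ej -ra ej rev_ordK eqxx.
move=> a ra; rewrite mxE; case: eqP => [ej|_].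
  by have := pos_ord_neq_rev j j; rewrite -ej ra eqxx.
case: eqP => [ej|//].
by have := pos_ord_neq_rev j j; rewrite -ej -ra ej rev_ordK eqxx.
Qed.

Lemma det_subtorus j x : x != 0 -> \det (subtorus j x) = 1.
Proof.
move=> x0; rewrite det_diag (bigD1 (pos_ord j)) //= (bigD1 (rev_ord (pos_ord j))) /=.
  rewrite !mxE !eqxx [_ == pos_ord j]eq_sym (negPf (pos_ord_neq_rev j j)).
  rewrite big1 ?mulr1 ?mulfV // => a /andP[ne1 ne2].
  by rewrite mxE (negPf ne1) (negPf ne2).
by rewrite eq_sym pos_ord_neq_rev.
Qed.

Lemma torus_Omega A : torus A -> A^T * Om * A = Om.
Proof.
case/torusP=> d [-> drev _]; rewrite tr_diag_mx; apply/matrixP => a b.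
rewrite -!mulmxE mul_mx_diag mul_diag_mx !mxE.
case: eqVneq => [->|]; last by rewrite mulr0 mul0r.
by rewrite mulr1 drev.
Qed.

(** Conjugation by [t] is trivial on the commutative torus, so [g * t] and [g] act on it alike. *)
Lemma torus_normalizer_mulr g t :
  torus_normalizer g -> torus t -> \det t = 1 -> torus_normalizer (g * t).
Proof.
move=> [gSO gT] Tt dett; have [detg gO] := gSO.
have tSO : SO_odd t by split=> //; apply: torus_Omega.
have [tU gU] := (SO_odd_unit tSO, SO_odd_unit gSO).
split.
  split; first by rewrite -mulmxE det_mulmx detg dett mulr1.
  rewrite -mulmxE trmx_mul !mulmxE -!mulrA [g^T * _]mulrA [g^T * Om * _]mulrA.
  by rewrite gO mulrA torus_Omega.
have tC A : torus A -> t * A = A * t.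
  case: Tt => dt _ -> /torusP[d [-> _ _]].
  by rewrite /torus_elt -!mulmxE diag_mxC.
have conj A : torus A <-> torus (t * A * t^-1).
  split=> [TA|TtA]; first by rewrite tC // mulrK.
  suff <-: t * A * t^-1 = A by [].
  by apply: (mulrI tU); rewrite (tC _ TtA) mulrVK.
move=> A; rewrite invrM // (_ : _ * _ = g * (t * A * t^-1) * g^-1); last first.
  by rewrite !mulrA.
exact: iff_trans (conj A) (gT _).
Qed.

End TorusNormalizer.

(** * Connected components of the normalizer *)

Section Component.

Variables (K : closedFieldType) (n : nat) (C : 'M[K]_((2 * n).+1) -> Prop).
Hypothesis charK0 : [pchar K] =i pred0.
Hypothesis C_comp : connected_component (@torus_normalizer K n) C.
Local Notation M := 'M[K]_((2 * n).+1).
Local Notation I := 'I_((2 * n).+1).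

Lemma component_normalizer g : C g -> torus_normalizer g.
Proof. by case: C_comp => _ + _; apply. Qed.

Lemma component_supported (g h : M) (w : I -> I) :
  C g -> supported w g -> C h -> supported w h.
Proof.
move=> Cg gw Ch; apply: NNPP => nhw.
have [[_ conC] CN _] := C_comp.
have alt A : C A -> supported w A \/ \prod_a A a (w a) = 0.
  move=> CA; have [w' Aw'] := torus_normalizer_supported charK0 (CN _ CA).
  (* Where the support of [A] differs from [w], the entry [A a (w a)] is zero and kills the
     product. *)
  have [/forallP ww'|/forallPn[a ne]] := boolP [forall a, w a == w' a].
    by left=> a b; rewrite (eqP (ww' a)); apply: Aw'.
  by right; rewrite (bigD1 a) //= Aw' // mul0r.
have [||A [CA Aw /eqP/prodf_eq0[a _ /eqP A0]]] := conC _ _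
    (zariski_closed_support _ w) (zariski_closed_prod _ w) alt.
- by exists g.
- by exists h; case: (alt h Ch).
have [ASO _] := CN _ CA.
by have := SO_odd_supported_neq0 ASO Aw a; rewrite A0 eqxx.
Qed.

Lemma component_mul_subtorus (g : M) j x :
  C g -> x != 0 -> C (g * subtorus j x).
Proof.
move=> Cg x0; have [conC CN Cmax] := C_comp.
pose D A := exists2 y, y != 0 & A = g * subtorus j y.
have conD : zariski_connected D.
  apply: laurent_curve_connected => a b.
  pose f (y : K) := g a b * (if b == pos_ord j then y
    else if b == rev_ord (pos_ord j) then y^-1 else 1).
  have [N [P fP]] : laurent f.
    apply: laurentM; first exact: laurent_cst.
    case: eqP => _; first exact: laurent_id.
    by case: eqP => _; [apply: laurent_inv | apply: laurent_cst].
  by exists N, P => y y0; rewrite -mulmxE mul_mx_diag !mxE; apply: fP.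
(* At parameter 1 the curve meets [C], so their union is connected. *)
have Dg : D g.
  exists 1; rewrite ?oner_neq0 // -[LHS]mulr1; congr (_ * _).
  apply/matrixP => a b; rewrite !mxE invr1.
  by case: (a == b); rewrite ?mulr0n //; do 2?case: eqP.
apply: (Cmax (fun A => C A \/ D A)); last by right; exists x.
- exact: zariski_connectedU conC conD Cg Dg.
- move=> A [/CN//|[y y0 ->]]; apply: torus_normalizer_mulr.
  + exact: CN.
  + exact: torus_subtorus.
  + exact: det_subtorus.
by move=> A; left.
Qed.

End Component.

(** * Iterating a permutation along one of its cycles *)

Section PermutationCycles.

Variables (T : finType) (s : {perm T}).

Lemma prod_porbit (R : comPzSemiRingType) (F : T -> R) x :
  \prod_(y in porbit s x) F y = \prod_(i < #|porbit s x|) F (iter i s x).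
Proof.
rewrite (eq_bigl _ _ (porbit_traject s x)) -big_uniq ?uniq_traject_porbit //=.
rewrite (big_nth x) size_traject big_mkord.
by apply: eq_bigr => i _; rewrite nth_traject.
Qed.

Lemma iter_porbit_neq x i :
  (0 < i < #|porbit s x|)%N -> iter i s x != x.
Proof.
move=> /andP[i_gt0 lt_is]; have s_gt0 : (0 < #|porbit s x|)%N by lia.
have := nth_uniq x _ _ (uniq_traject_porbit s x); rewrite size_traject.
move=> /(_ i 0%N lt_is s_gt0); rewrite !nth_traject // => ->.
by rewrite -lt0n.
Qed.

Lemma iter_porbit_dvdn x e : iter e s x = x -> (#|porbit s x| %| e)%N.
Proof.
have := @iter_porbit_neq x; have := iter_porbit s x.
have: (0 < #|porbit s x|)%N by rewrite lt0n card_porbit_neq0.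
move: #|_| => k k_gt0 iter_k neq_k ex; apply/eqP.
have [//|r_gt0] := posnP (e %% k).
have /negP[] := neq_k (e %% k)%N (introT andP (conj r_gt0 (ltn_pmod e k_gt0))).
apply/eqP; rewrite -[RHS]ex [in RHS](divn_eq e k) addnC iterD iterM.
by rewrite [iter (e %/ k) _ _]iter_fix.
Qed.

End PermutationCycles.

(** * Signed permutations acting on the weights *)

Section SignedPermutation.

Variables (n : nat) (sigma : 'S_n) (eps : 'I_n -> int).
Hypothesis eps_sign : forall i, eps i = 1 \/ eps i = -1.
Local Notation I := 'I_((2 * n).+1).

(** The sign -1 negates a weight, which on indices is [rev_ord]. *)
Definition flip (e : int) (a : I) : I := if e == 1 then a else rev_ord a.

Definition path_sign k j := \prod_(i < k) eps (iter i sigma j).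

Lemma prod_eps_sign J (r : seq J) (P : pred J) (f : J -> 'I_n) :
  \prod_(i <- r | P i) eps (f i) = 1 \/ \prod_(i <- r | P i) eps (f i) = -1.
Proof.
apply: (big_ind (fun e => e = 1 \/ e = -1)); first by left.
  by move=> _ _ [->|->] [->|->]; rewrite ?mulrNN ?mul1r ?mulr1; auto.
by move=> i _; apply: eps_sign.
Qed.

Lemma flip_mul e e' a : (e = 1 \/ e = -1) -> (e' = 1 \/ e' = -1) ->
  flip e (flip e' a) = flip (e * e') a.
Proof. by move=> [->|->] [->|->]; rewrite /flip //= rev_ordK. Qed.

Lemma flip_pos_ord_inj e i j : (e = 1 \/ e = -1) ->
  flip e (pos_ord i) = pos_ord j -> e = 1 /\ i = j.
Proof.
case=> ->; rewrite /flip /=; first by move/pos_ord_inj.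
by move/esym/eqP; rewrite (negPf (pos_ord_neq_rev _ _)).
Qed.

Variable w : I -> I.
Hypothesis w_rev : forall a, w (rev_ord a) = rev_ord (w a).

Lemma iter_rev k a : iter k w (rev_ord a) = rev_ord (iter k w a).
Proof. by elim: k => //= k ->. Qed.

Hypothesis w_pos : forall j, w (pos_ord j) = flip (eps j) (pos_ord (sigma j)).

Lemma iter_pos k j :
  iter k w (pos_ord j) = flip (path_sign k j) (pos_ord (iter k sigma j)).
Proof.
elim: k => [|k IHk] /=; first by rewrite /path_sign big_ord0.
have -> : path_sign k.+1 j = path_sign k j * eps (iter k sigma j).
  by rewrite /path_sign big_ord_recr.
rewrite -flip_mul //; last exact: prod_eps_sign.
by rewrite -w_pos IHk /flip; case: ifP => // _; rewrite w_rev.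
Qed.

Lemma iter_porbit_pos j :
  iter #|porbit sigma j| w (pos_ord j) =
    flip (\prod_(i in porbit sigma j) eps i) (pos_ord j).
Proof. by rewrite iter_pos iter_porbit /path_sign -prod_porbit. Qed.

Lemma path_sign_mul q j : path_sign (q * #|porbit sigma j|) j =
  (\prod_(i in porbit sigma j) eps i) ^+ q.
Proof.
elim: q => [|q IHq]; first by rewrite /path_sign mul0n big_ord0.
rewrite exprS mulSn -{}IHq prod_porbit /path_sign big_split_ord /=.
congr (_ * _); apply: eq_bigr => i _; congr (eps _).
by rewrite addnC iterD iter_porbit.
Qed.

(** Coming back to the same weight, not to its mirror image, takes a whole number [q] of turns with
    accumulated sign [(-1) ^+ q = 1], so [q] is even. *)
Lemma iter_pos_fixed_dvdn e j :
    \prod_(i in porbit sigma j) eps i = -1 ->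
  iter e w (pos_ord j) = pos_ord j -> (2 * #|porbit sigma j| %| e)%N.
Proof.
move=> signj; rewrite iter_pos => /flip_pos_ord_inj[].
  exact: prod_eps_sign.
move=> sign_e /iter_porbit_dvdn/dvdnP[q def_e].
move: sign_e; rewrite def_e path_sign_mul signj -signr_odd => sign_q.
rewrite dvdn_pmul2r; last by apply/card_gt0P; exists j; apply: porbit_id.
by rewrite dvdn2; case: (odd q) sign_q.
Qed.

End SignedPermutation.

(** * Powers of a normalizer element and the signed permutation it induces *)

Lemma torus_diag_rev (K : fieldType) n (d : 'rV[K]_((2 * n).+1)) a :
  torus (diag_mx d) -> d 0 (rev_ord a) = (d 0 a)^-1.
Proof.
case/torusP=> d' [dd' d'rev _]; have -> : d = d'.
  apply/rowP => b; have := congr1 (fun A : 'M_ _ => A b b) dd'.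
  by rewrite !mxE eqxx.
exact/esym/mulr1_eq.
Qed.

Section NormalizerPowers.

Variables (K : fieldType) (n : nat) (g : 'M[K]_((2 * n).+1)).
Variable w : 'I_((2 * n).+1) -> 'I_((2 * n).+1).
Hypotheses (gSO : SO_odd g) (gw : supported w g).

Lemma row_exp_half_turn k a : iter k w a = rev_ord a ->
  row a (g ^+ (2 * k)) = row a 1%:M.
Proof.
move=> wka; rewrite (_ : (2 * k = k + k)%N); last by lia.
apply/rowP => b; rewrite !mxE (supportedX _ _ _ gw).
have w_rev := iter_rev (SO_odd_supported_rev gSO gw).
have -> : iter (k + k) w a = a.
  by rewrite iterD wka w_rev wka rev_ordK.
(* The factor at step [k + i] sits at the mirror image of the one at step [i], so the two are
   mutually inverse. *)
rewrite big_split_ord /= -big_split big1 ?[b == a]eq_sym //= => i _.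
rewrite addnC iterD wka w_rev.
exact: SO_odd_supported_mulrev.
Qed.

(** At a regular torus element, the conjugation and the pair each give the value of the conjugated
    character as a diagonal entry; injectivity of the diagonal identifies the two positions. *)
Lemma supported_induces (sigma : 'S_n) eps : [pchar K] =i pred0 ->
    (forall i, eps i = 1 \/ eps i = -1) ->
    torus_normalizer g -> induces g sigma eps ->
  forall j, w (pos_ord j) = flip (eps j) (pos_ord (sigma j)).
Proof.
move=> charK0 eps_sign Ng g_ind j; have [d Td d_inj] := torus_regular n charK0.
have [d' [gd gd']] := torus_normalizer_conj Ng Td.
have := g_ind j _ Td; rewrite /char_action /chi gd -!/(pos_ord _) !mxE !eqxx !mulr1n.
have := congr1 (fun A : 'M_ _ => A (pos_ord j) (w (pos_ord j))) gd'.
rewrite -!mulmxE mul_mx_diag mul_diag_mx !mxE mulrC.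
move/(mulIf (SO_odd_supported_neq0 gSO gw _)) <- => dw.
apply: d_inj; rewrite dw /flip; case: (eps_sign j) => -> //=.
by rewrite torus_diag_rev.
Qed.

End NormalizerPowers.

(** * Cycles of sign 1 and of sign -1 *)

Section CycleHolonomy.

Variables (K : fieldType) (n : nat) (g : 'M[K]_((2 * n).+1)).
Variables (sigma : 'S_n) (eps : 'I_n -> int).
Variable w : 'I_((2 * n).+1) -> 'I_((2 * n).+1).
Hypotheses (gSO : SO_odd g) (gw : supported w g).
Hypothesis eps_sign : forall i, eps i = 1 \/ eps i = -1.
Hypothesis w_pos : forall j, w (pos_ord j) = flip (eps j) (pos_ord (sigma j)).

Lemma supported_mul_subtorus j x : supported w (g * subtorus j x).
Proof.
by move=> a b /gw g0; rewrite -mulmxE mul_mx_diag mxE g0 mul0r.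
Qed.

(* A cycle of sign 1 returns to its starting weight after visiting each weight
   once, so its holonomy can be rescaled at will by the torus. *)
Lemma row_exp_untwisted j c : \prod_(i in porbit sigma j) eps i = 1 -> c != 0 ->
  exists2 x, x != 0 &
    row (pos_ord j) ((g * subtorus j x) ^+ #|porbit sigma j|) =
      c *: row (pos_ord j) 1%:M.
Proof.
move=> sign1 c0; set a := pos_ord j; set s := #|_|.
pose hol := \prod_(i < s) g (iter i w a) (iter i.+1 w a).
have w_rev := SO_odd_supported_rev gSO gw.
have wsa : iter s w a = a.
  by rewrite (iter_porbit_pos eps_sign w_rev w_pos) sign1.
have hol0 : hol != 0.
  by apply/prodf_neq0 => i _; apply: SO_odd_supported_neq0.
(* The torus factor multiplies the holonomy [hol] by exactly [x]. *)
exists (c / hol); first by rewrite mulf_neq0 ?invr_eq0.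
apply/rowP => b; rewrite mxE (supportedX _ _ _ (@supported_mul_subtorus j _)) wsa.
rewrite !mxE [a == b]eq_sym mulr_natr; congr (_ *+ _).
under eq_bigr do rewrite -mulmxE mul_mx_diag !mxE.
rewrite big_split -/hol /=; set tau := \prod_(i < s) _.
suff -> : tau = c / hol by rewrite mulrCA mulfV ?mulr1.
rewrite /tau; have s_gt0 : (0 < s)%N by rewrite lt0n card_porbit_neq0.
(* Only the last step enters column [a], contributing [x]; the earlier steps miss [a] and its mirror
   image, as their iterates under [sigma] differ from [j]. *)
rewrite -(prednK s_gt0) big_ord_recr /= -iterS prednK // wsa eqxx.
rewrite big1 ?mul1r // => i _; rewrite -iterS.
have ne_ij : iter i.+1 sigma j != j.
  by apply: iter_porbit_neq; have := ltn_ord i; rewrite -/s; lia.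
rewrite /a (iter_pos eps_sign w_rev w_pos).
have := prod_eps_sign eps_sign (index_enum 'I_i.+1) predT (fun k => iter k sigma j).
rewrite /path_sign /flip => -[] -> /=; rewrite -!iterS.
  by rewrite (inj_eq (@pos_ord_inj _)) (negPf ne_ij) (negPf (pos_ord_neq_rev _ _)).
rewrite eq_sym (negPf (pos_ord_neq_rev _ _)).
by rewrite (inj_eq rev_ord_inj) (inj_eq (@pos_ord_inj _)) (negPf ne_ij).
Qed.

(** Each index reaches its mirror image after a number of steps dividing [L]; two such half turns
    give the identity on that row. *)
Lemma exp_twisted_eq1 L :
  (forall j, \prod_(i in porbit sigma j) eps i = -1) ->
  (forall j, (#|porbit sigma j| %| L)%N) -> g ^+ (2 * L) = 1.
Proof.
move=> twisted dvdL; have w_rev := SO_odd_supported_rev gSO gw.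
apply/row_matrixP => a.
suff [k kL wka] : exists2 k, (k %| L)%N & iter k w a = rev_ord a.
  apply: (row_exp_eq1 (k := (2 * k)%N)); first by rewrite dvdn_pmul2l.
  exact (row_exp_half_turn gSO gw wka).
have turn j : iter #|porbit sigma j| w (pos_ord j) = rev_ord (pos_ord j).
  by rewrite (iter_porbit_pos eps_sign w_rev w_pos) twisted.
case: (ordP a) => [j|j|{}a ra].
- by exists #|porbit sigma j|.
- by exists #|porbit sigma j|; rewrite // (iter_rev w_rev) turn.
(* The middle index is fixed by [rev_ord] and by [w], so one step already counts as a half turn. *)
exists 1%N => //=; apply: val_inj; rewrite ra.
have /eqP -> : val a == n by rewrite -rev_ord_fixed ra.
by apply/eqP; rewrite -rev_ord_fixed -w_rev ra.
Qed.

End CycleHolonomy.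

Theorem mainTheorem10 (K : closedFieldType) (charK0 : [pchar K] =i pred0)
    (n : nat) (n_ge1 : (1 <= n)%N)
    (sigma : 'S_n) (eps : 'I_n -> int)
    (eps_sign : forall i, eps i = 1 \/ eps i = -1)
    (C : 'M[K]_((2 * n).+1) -> Prop)
    (C_comp : connected_component (@torus_normalizer K n) C)
    (C_pair : corresponds C sigma eps) :
  (periodic C <->
     (forall O : {set 'I_n}, O \in porbits sigma ->
        \prod_(i in O) eps i = -1)) /\
  (periodic C ->
     forall g, C g ->
       has_order g (2 * \big[lcmn/1%N]_(O in porbits sigma) #|O|)%N).
Proof.
have [g0 Cg0 g0_ind] := C_pair.
have Ng0 := component_normalizer C_comp Cg0; have [g0SO _] := Ng0.
have [w g0w] := torus_normalizer_supported charK0 Ng0.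
have w_pos := supported_induces g0SO g0w charK0 eps_sign Ng0 g0_ind.
have CSO g : C g -> SO_odd g by case/(component_normalizer C_comp).
have Cw g : C g -> supported w g by apply: component_supported g0w.
set L := \big[lcmn/1%N]_(O in porbits sigma) #|O|.
have dvdL j : (#|porbit sigma j| %| L)%N.
  by apply: (biglcmn_sup (porbit sigma j)); rewrite ?imset_f.
have L_gt0 : (0 < L)%N.
  rewrite /L; apply: (big_ind (fun k => 0 < k)%N) => // [k l|O].
    by rewrite lcmn_gt0 => -> ->.
  by case/imsetP=> j _ ->; rewrite lt0n card_porbit_neq0.
have twisted_exp g : C g ->
    (forall j, \prod_(i in porbit sigma j) eps i = -1) -> g ^+ (2 * L) = 1.
  move=> Cg tw.
  exact: exp_twisted_eq1 (CSO _ Cg) (Cw _ Cg) eps_sign w_pos _ tw dvdL.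
have periodic_twisted : periodic C ->
    forall j, \prod_(i in porbit sigma j) eps i = -1.
  move=> perC j; case: (prod_eps_sign eps_sign (index_enum 'I_n)
    (mem (porbit sigma j)) id) => // sign1.
  have two0 : 2%:R != 0 :> K by have /pcharf0P-> := charK0.
  have [x x0 row2] := row_exp_untwisted g0SO g0w eps_sign w_pos sign1 two0.
  (* A power of this translate has eigenvalue 2, so finite order would make a positive power of 2
     equal to 1. *)
  have [d d_gt0 hd] := perC _ (component_mul_subtorus C_comp j Cg0 x0).
  have := row_expM d row2; rewrite exprM hd expr1n.
  move/rowP/(_ (pos_ord j)); rewrite !mxE eqxx mulr1 -natrX.
  move/(pchar0_natr_inj charK0 (x1 := 1%N)) => /esym/eqP.
  by rewrite -(expn0 2) eqn_exp2l // => /eqP d0; rewrite d0 in d_gt0.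
split; first split.
- by move=> perC O /imsetP[j _ ->]; apply: periodic_twisted.
- move=> tw g Cg; exists (2 * L)%N; first by rewrite muln_gt0.
  by apply: twisted_exp => // j; apply: tw; apply: imset_f.
move=> /periodic_twisted tw g Cg; split.
- by rewrite muln_gt0.
- exact: twisted_exp.
move=> e e_gt0 ge1; apply: dvdn_leq => //.
have dvd_e j : (2 * #|porbit sigma j| %| e)%N.
  have w_rev := SO_odd_supported_rev (CSO _ Cg) (Cw _ Cg).
  apply: (iter_pos_fixed_dvdn eps_sign w_rev w_pos (tw j)).
  exact (supportedX_eq1_fixed _ (Cw _ Cg) ge1).
(* As [n] is positive there is a cycle, which shows that [e] is even; halving leaves divisibility by
   the lcm. *)
have /dvdnP[q def_e] := dvdn_trans (dvdn_mulr _ (dvdnn 2)) (dvd_e (Ordinal n_ge1)).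
rewrite def_e mulnC dvdn_pmul2r //; apply/dvdn_biglcmP => _ /imsetP[j _ ->].
by have := dvd_e j; rewrite def_e mulnC dvdn_pmul2r.
Qed.
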